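(* Let $G\cong(\underbrace{0,\ldots,0}_{k_1},1,\underbrace{0,\ldots,0}_{k_2},1)$ be a threshold graph of order $n\ge 5$ with $k_1\ge 1$ and $k_2\ge 0$. Then $q(G)=3$ if $k_1\in\{1,2\}$ or $k_2\in\{0,1\}$, and $q(G)=4$ otherwise.
   Context: For a simple graph $G$ on $n$ vertices, $S(G)$ is the set of all real symmetric $n\times n$ matrices $A=(a_{ij})$ such that for $i\neq j$, $a_{ij}\neq 0$ if and only if $ij\in E(G)$ (diagonal entries are unrestricted). $q(A)$ is the number of distinct eigenvalues of $A$ and $q(G)=\min\{q(A): A\in S(G)\}$. The notation $G\cong(b_1,\ldots,b_n)$, with $b_i\in\{0,1\}$ and $b_1=0$, means that $G$ is the threshold graph with creation sequence $(b_1,\ldots,b_n)$: its vertices are $v_1,\ldots,v_n$ and, for $i<j$, $v_i$ and $v_j$ are adjacent if and only if $b_j=1$. *)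

(* Defs.v *)
From HB Require Import structures.
From mathcomp Require Import all_boot all_order all_algebra.
From mathcomp Require Import finmap.
From mathcomp Require Import all_classical all_reals.

Set Implicit Arguments.
Unset Strict Implicit.
Unset Printing Implicit Defensive.

Import Order.TTheory GRing.Theory Num.Theory.
Local Open Scope ring_scope.

Record sgraph (n : nat) := SGraph {
  adj :> rel 'I_n;
  adj_sym : symmetric adj;
  adj_irr : irreflexive adj
}.

Definition in_S (R : realType) (n : nat) (G : sgraph n) (A : 'M[R]_n) : Prop :=
  A^T = A /\ forall i j : 'I_n, i != j -> (A i j != 0) = G i j.

(* Only eigenvalues in [R] are counted: for symmetric [A] these are all of them.
   [fset_set] is meaningful because the set is finite, see
   [finite_eigenvalues] below. *)
Definition q_mx (R : realType) (n : nat) (A : 'M[R]_n) : nat :=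
  #|` fset_set [set a : R | eigenvalue A a]|.

Lemma finite_eigenvalues (R : realType) (n : nat) (A : 'M[R]_n) :
  finite_set [set a : R | eigenvalue A a].
Proof.
apply: contrapT => /(infinite_set_fset (size (char_poly A))) [F FA].
apply/negP; rewrite -ltnNge; apply: max_poly_roots.
- exact/monic_neq0/char_poly_monic.
- by apply/allP => a /FA /=; rewrite eigenvalue_root_char.
- exact: fset_uniq.
Qed.

Definition attains_q (R : realType) (n : nat) (G : sgraph n) : pred nat :=
  fun k => `[< exists2 A : 'M[R]_n, in_S G A & q_mx A = k >].

Lemma attains_q_ex (R : realType) (n : nat) (G : sgraph n) :
  exists k, attains_q R G k.
Proof.
pose A : 'M[R]_n := \matrix_(i, j) (G i j)%:R.
exists (q_mx A); apply/asboolP; exists A => //; split.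
  by apply/matrixP => i j; rewrite !mxE adj_sym.
by move=> i j _; rewrite mxE pnatr_eq0 eqb0 negbK.
Qed.

Definition q_graph (R : realType) (n : nat) (G : sgraph n) : nat :=
  ex_minn (attains_q_ex R G).

(* [v i] is the vertex v_{i+1} of the creation order and [nth _ b i] is
   b_{i+1}, so the later of two vertices has index [maxn i j]. *)
Definition is_threshold (n : nat) (G : sgraph n) (b : seq bool) : Prop :=
  [/\ size b = n, nth true b 0 = false &
      exists2 v : 'I_n -> 'I_n, bijective v &
        forall i j : 'I_n, G (v i) (v j) = (i != j) && nth false b (maxn i j)].

(* Main.v *)
(* Write u, v for the two dominating vertices (u first), S for the k1 vertices
   before u, and P for the k2 vertices between u and v, which are pendant at v.

   Lower bounds: a real symmetric M with m distinct eigenvalues satisfies a monic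
   relation of degree m, whose entries are explicit because a row of M outside u
   and v has at most three nonzero entries.  Degree 2 fails at a pair in S x P,
   or, when P is empty, because three nonzero vectors of the plane would be
   pairwise orthogonal.  In degree 3 with k1 >= 3 and k2 >= 2, the entries at
   pairs of vertices outside u and v force M to be constant on the diagonal of P
   (value de) and of S (value d <> de), with proportional columns u and v on S.
   Then de and d are roots of the cubic, and the entries at P x {v} and S x {v}
   give two incompatible signs for (d - de) * (M u u - de).

   Upper bounds: explicit matrices, whose twin vertices contribute the
   eigenvalues on their diagonal and whose remaining spectrum is that of a
   quotient of order at most 5. *)
Require Import Defs.
From mathcomp Require Import all_boot all_order all_algebra.
From mathcomp Require Import finmap complex.
From mathcomp Require Import all_classical all_reals.
From mathcomp Require Import ring lra zify.

Set Implicit Arguments.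
Unset Strict Implicit.
Unset Printing Implicit Defensive.

Import Order.TTheory GRing.Theory Num.Theory.
Local Open Scope ring_scope.

(** * Distinct eigenvalues and annihilating polynomials of a real symmetric matrix *)

Lemma mem_eigenvalues (R : realType) (n : nat) (A : 'M[R]_n) (a : R) :
  (a \in fset_set [set x : R | eigenvalue A x]) = eigenvalue A a.
Proof.
by rewrite in_fset_set ?mem_setE //; exact: finite_eigenvalues.
Qed.

Lemma q_mx_le (R : realType) (n : nat) (A : 'M[R]_n) (rs : seq R) :
  (forall a, eigenvalue A a -> a \in rs) -> (q_mx A <= size rs)%N.
Proof.
move=> Ars; rewrite /q_mx; apply: uniq_leq_size; first exact: fset_uniq.
by move=> a; rewrite mem_eigenvalues => /Ars.
Qed.

(** Over the complex numbers [A] becomes Hermitian, hence unitarily diagonalizable with a real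
    spectrum, so a product with one linear factor per distinct real eigenvalue already kills every
    diagonal entry. *)
Lemma symmetric_annihilator (R : realType) (n : nat) (A : 'M[R]_n.+1) :
  A^T = A ->
  horner_mx A (\prod_(a <- fset_set [set x : R | eigenvalue A x])
    ('X - a%:P)) = 0.
Proof.
move=> symA; set F := fset_set _; set p := \prod_(_ <- _) _.
pose f := real_complex R; pose B := map_mx f A.
have hermB : B \is hermsymmx.
  apply: realsym_hermsym.
    apply/is_hermitianmxP; rewrite expr0 scale1r map_mx_id//.
    by rewrite /B map_trmx symA.
  by apply/mxOverP => i j; rewrite mxE; apply/complex_realP; exists (A i j).
have Breal := hermitian_spectral_diag_real hermB.
have /hermitian_normalmx/orthomx_spectralP BE := hermB.
set P := spectralmx B in BE; set D := spectral_diag B in BE Breal.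
have Punit : P \in unitmx by exact: spectral_unit.
have rootD i : root (map_poly f p) (D 0 i).
  have /mxOverP/(_ 0 i)/complex_realP[d dE] := Breal.
  rewrite dE; apply/rmorph_root.
  rewrite /p root_prod_XsubC mem_eigenvalues eigenvalue_root_char.
  rewrite -(fmorph_root f) map_char_poly -/B -eigenvalue_root_char.
  (* Row [i] of the unitary matrix is a left eigenvector for [D 0 i]; it is nonzero since [P] is
     invertible. *)
  apply/eigenvalueP; exists (row i P); last first.
    apply/eqP => /(congr1 (mulmx^~ (invmx P))).
    rewrite -row_mul mulmxV// mul0mx => /rowP/(_ i)/eqP.
    by rewrite !mxE eqxx oner_eq0.
  rewrite -row_mul BE !mulmxA mulmxV// mul1mx row_mul row_diag_mx -scalemxAl.
  by rewrite -rowE dE.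
apply: (@map_mx_inj _ _ f); rewrite map_mx0 map_horner_mx -/B BE.
rewrite horner_mx_uconjC // horner_mx_diag (_ : map_mx _ _ = 0).
  by rewrite [diag_mx _]linear0 mulmx0 mul0mx.
by apply/rowP => i; rewrite !mxE; apply/eqP/rootD.
Qed.

(** Multiplying the annihilator by a power of ['X] brings its degree to exactly [m], so the lower
    bounds can argue with a fixed degree. *)
Lemma symmetric_monic_relation (R : realType) (n m : nat) (A : 'M[R]_n.+1) :
  A^T = A -> (q_mx A <= m)%N ->
  exists c : nat -> R, A ^+ m + \sum_(k < m) c k *: A ^+ k = 0.
Proof.
move=> symA qm; have := symmetric_annihilator symA.
set p := \prod_(_ <- _) _ => pA.
have pmon : p \is monic by exact: monic_prod_XsubC.
have sz : size p = (q_mx A).+1 by rewrite size_prod_XsubC.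
pose p' := p * 'X^(m - q_mx A).
have p'mon : p' \is monic by rewrite monicMr ?monicXn.
have sz' : size p' = m.+1.
  rewrite size_Mmonic ?monicXn ?monic_neq0// size_polyXn sz addnS /=.
  by rewrite addSn subnKC.
have H : horner_mx A p' = 0 by rewrite rmorphM /= pA mul0r.
exists (fun k => p'`_k).
rewrite -[RHS]H -[in RHS](coefK p') sz' poly_def big_ord_recr /= addrC.
rewrite rmorphD rmorph_sum /= !linearZ /= !rmorphXn /= !horner_mx_X.
have := p'mon; rewrite monicE lead_coefE sz' /= => /eqP ->; rewrite scale1r.
congr (_ + _); apply: eq_bigr => i _.
by rewrite linearZ /= rmorphXn /= horner_mx_X.
Qed.

(** * The threshold graph described by its two dominating vertices *)

(* [u] and [v] are the two dominating vertices of the creation sequence, [u]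
   the earlier one, and [S] is the set of vertices preceding [u]. *)
Definition two_dominating (n : nat) (G : sgraph n) (u v : 'I_n)
    (S : {set 'I_n}) : Prop :=
  [/\ u != v, u \notin S, v \notin S &
      forall i j : 'I_n, i != j ->
        G i j = [|| i == v, j == v, (i == u) && (j \in S)
                  | (j == u) && (i \in S)]].

Definition pendant (n : nat) (u v : 'I_n) (S : {set 'I_n}) : {set 'I_n} :=
  ~: (u |: (v |: S)).

(** The sequence is true exactly at the indices [k1] and [(k1 + k2).+1]; these give [u] and [v], and
    the indices below [k1] give [S]. *)
Lemma threshold_two_dominating (n k1 k2 : nat) (G : sgraph n) :
  is_threshold G
    (nseq k1 false ++ [:: true] ++ nseq k2 false ++ [:: true]) ->
  exists u v S, [/\ two_dominating G u v S, #|S| = k1,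
    #|pendant u v S| = k2 & n = (k1 + k2).+2].
Proof.
case=> sz _ [w wbij wG]; have winj := bij_inj wbij.
have nE : n = (k1 + k2).+2.
  by rewrite -sz !(size_cat, size_nseq) /=; lia.
have nthE m : nth false
    (nseq k1 false ++ [:: true] ++ nseq k2 false ++ [:: true]) m =
    (m == k1) || (m == (k1 + k2).+1).
  rewrite nth_cat size_nseq nth_nseq; case: (ltngtP m k1) => [lt|gt|->] /=.
  - by apply/esym/negbTE; lia.
  - case E: (m - k1)%N => [|d] /=; first by lia.
    rewrite nth_cat size_nseq nth_nseq if_same.
    case: ltnP => [h|h]; first by apply/esym/negbTE; lia.
    case E': (d - k2)%N => [|d'] /=; first by apply/esym; lia.
    by rewrite nth_nil; apply/esym/negbTE; lia.
  - by rewrite subnn.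
have ltu : (k1 < n)%N by rewrite nE; lia.
have ltv : ((k1 + k2).+1 < n)%N by rewrite nE; lia.
pose u' := Ordinal ltu; pose v' := Ordinal ltv.
pose S := w @: [set i : 'I_n | (i < k1)%N].
have wS i : (w i \in S) = (i < k1)%N by rewrite mem_imset // inE.
have cS : #|S| = k1.
  rewrite card_imset // -sum1dep_card.
  by rewrite -(big_ord_widen n (fun=> 1%N) (ltnW ltu)) sum_nat_const card_ord muln1.
exists (w u'), (w v'), S; split => //.
- split; rewrite ?wS //=; first by rewrite (inj_eq winj) -val_eqE /=; lia.
  + by rewrite ltnn.
  + by lia.
  + move=> i j ij; have [w' wK w'K] := wbij.
    rewrite -(w'K i) -(w'K j) wG nthE !wS !(inj_eq winj) -!val_eqE /=.
    have {}ij : w' i != w' j by rewrite (inj_eq (can_inj w'K)).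
    rewrite ij /=; move: ij; rewrite -val_eqE /=.
    have := ltn_ord (w' i); have := ltn_ord (w' j).
    by case: (leqP (w' i) (w' j)); lia.
- have := cardsC (w u' |: (w v' |: S)); rewrite !cardsU1 !inE !wS cS card_ord.
  rewrite (inj_eq winj) -val_eqE /= /pendant.
  rewrite (_ : (k1 == (k1 + k2).+1) = false); last by apply/negbTE; lia.
  rewrite ltnn (_ : ((k1 + k2).+1 < k1)%N = false) /=; last by apply/negbTE;
    lia.
  by set c := #|_|; move: c => c; lia.
Qed.

Lemma sum_two_dominating (V : nmodType) (n : nat) (G : sgraph n) (u v : 'I_n)
    (S : {set 'I_n}) (f : 'I_n -> V) : two_dominating G u v S ->
  \sum_i f i =
    f u + f v + \sum_(i in S) f i + \sum_(i in pendant u v S) f i.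
Proof.
case=> uv uS vS _; rewrite (bigD1 u) //= (bigD1 v) 1?eq_sym //= -!addrA.
congr (_ + (_ + _)); rewrite (bigID [in S]) /=; congr (_ + _).
  apply: eq_bigl => i; have [iS|] := boolP (i \in S); last by rewrite andbF.
  by rewrite andbT; apply/andP; split; apply: contraTneq iS => ->.
by apply: eq_bigl => i; rewrite !inE !negb_or andbA.
Qed.

(** * Lower bounds from quadratic and cubic matrix relations *)

Section LowerBounds.
Context (R : realType) (n : nat) (G : sgraph n.+1) (u v : 'I_n.+1).
Context (S : {set 'I_n.+1}) (M : 'M[R]_n.+1).
Hypotheses (Guv : two_dominating G u v S) (MG : in_S G M).

Let uv : u != v. Proof. by case: Guv. Qed.
Let Msym i j : M i j = M j i.
Proof. by case: MG => /matrixP/(_ j i); rewrite mxE. Qed.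
Let Mneq0 i j : i != j -> (M i j != 0) = G i j.
Proof. by case: MG => _; apply. Qed.
Let SnB x : x \in S -> x != u /\ x != v.
Proof.
by case: Guv => _ uS vS _ xS; split; apply: contraTneq xS => ->.
Qed.
Let PnB x : x \in pendant u v S -> [/\ x != u, x != v & x \notin S].
Proof. by rewrite !inE !negb_or => /and3P. Qed.

Lemma entry_v i : i != v -> M i v != 0.
Proof. by move=> iv; rewrite Mneq0 //; case: Guv => _ _ _ ->;
  rewrite ?eqxx ?orbT. Qed.

Lemma entry_u i : i \in S -> M i u != 0.
Proof.
move=> iS; have [iu _] := SnB iS; rewrite Mneq0 //.
by case: Guv => _ _ _ ->; rewrite ?eqxx ?iS ?orbT.
Qed.

(** The last hypothesis lets one statement cover both pairs of vertices outside [u] and [v] and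
    pairs of a pendant vertex with [u]. *)
Lemma entry_eq0 i j : i != u -> i != v -> j != v -> i != j ->
  (j == u) ==> (i \notin S) -> M i j = 0.
Proof.
move=> iu iv jv ij ju; apply/eqP; rewrite -[_ == _]negbK Mneq0 //.
case: Guv => _ _ _ ->; rewrite ?(negbTE iu) ?(negbTE iv) ?(negbTE jv) //=.
by case: (j == u) ju.
Qed.

Lemma row_mulmx (N : 'M[R]_n.+1) i j : i != u -> i != v ->
  (M * N) i j = M i i * N i j + M i u * N u j + M i v * N v j.
Proof.
move=> iu iv; rewrite mxE (bigD1 i) //= (bigD1 u) 1?eq_sym //=.
rewrite (bigD1 v) /=; last by rewrite ![v == _]eq_sym iv uv.
rewrite big1 ?addr0 ?addrA // => k /andP[/andP[ki ku] kv].
by rewrite (entry_eq0 iu iv kv) ?mul0r ?(negbTE ku) // eq_sym.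
Qed.

Lemma row_mulmx_pendant (N : 'M[R]_n.+1) i j : i \in pendant u v S ->
  (M * N) i j = M i i * N i j + M i v * N v j.
Proof.
move=> /PnB[iu iv iS];
  rewrite row_mulmx // (entry_eq0 (j := u)) ?mul0r ?addr0 //.
by rewrite eqxx.
Qed.

(** Off the diagonal the constant term of the quadratic relation disappears. *)
Lemma quadratic_offdiag : (q_mx M <= 2)%N ->
  exists s, forall i j, i != j -> (M * M) i j + s * M i j = 0.
Proof.
move=> /(symmetric_monic_relation (proj1 MG))[c /matrixP H];
  exists (c 1%N) => i j ij.
rewrite -mulmxE -[M *m M]/(M ^+ 2); move: (M ^+ 2) H => N H.
have := H i j; rewrite !big_ord_recl big_ord0 /= addr0 expr0 expr1 !mxE.
by rewrite (negbTE ij) mulr0n mulr0 add0r.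
Qed.

Lemma cubic_entry : (q_mx M <= 3)%N ->
  exists s t r, forall i j,
    (M * (M * M)) i j + s * (M * M) i j + t * M i j + r * (i == j)%:R = 0.
Proof.
move=> /(symmetric_monic_relation (proj1 MG))[c /matrixP H].
exists (c 2%N), (c 1%N), (c 0%N) => i j.
rewrite -[M * (M * M)]/(M ^+ 3) -[M * M]/(M ^+ 2).
have := H i j; rewrite !big_ord_recl big_ord0 /bump /= addr0 expr0 expr1.
move: (M ^+ 3) (M ^+ 2) => N3 N2; rewrite !mxE => <-.
by rewrite -mulr_natr; ring.
Qed.

(** A pendant vertex and a vertex of [S] are not adjacent and have [v] as their only common
    neighbour, so their entry in [M * M] is a single nonzero product. *)
Lemma q_mx_gt2_pendant : (0 < #|S|)%N -> (0 < #|pendant u v S|)%N ->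
  (2 < q_mx M)%N.
Proof.
move=> /card_gt0P[a aS] /card_gt0P[b bP]; rewrite ltnNge; apply/negP.
move=> /quadratic_offdiag[s H].
have [bu bv bS] := PnB bP; have [au av] := SnB aS.
have ba : b != a by apply: contraNneq bS => ->.
have := H b a ba; rewrite row_mulmx_pendant // (entry_eq0 bu bv av ba) ?(negbTE au) //.
rewrite !mulr0 add0r addr0 => /eqP; rewrite mulf_eq0 (negbTE (entry_v bv)) /=.
by rewrite Msym (negbTE (entry_v av)).
Qed.

Lemma q_mx_gt2_twins : (2 < #|S|)%N -> (2 < q_mx M)%N.
Proof.
move=> /card_gt2P[a [b [c [[aS bS cS] [ab bc ca]]]]].
rewrite ltnNge; apply/negP => /quadratic_offdiag[s H].
have orth x y : x \in S -> y \in S -> x != y ->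
    M x u * M y u + M x v * M y v = 0.
  move=> xS yS xy; have [xu xv] := SnB xS; have [yu yv] := SnB yS.
  have Mxy : M x y = 0 by apply: entry_eq0; rewrite ?(negbTE yu).
  by have := H x y xy; rewrite row_mulmx // Mxy !mulr0 add0r addr0 !(Msym _ y).
have ha := entry_u aS; have hb := entry_u bS; have hc := entry_u cS.
have := orth a b aS bS ab; have := orth b c bS cS bc; have := orth c a cS aS ca.
set p1 := M a u in ha *; set p2 := M b u in hb *; set p3 := M c u in hc *.
set q1 := M a v; set q2 := M b v; set q3 := M c v => /eqP.
rewrite addr_eq0 => /eqP e31 /eqP; rewrite addr_eq0 => /eqP e23 /eqP.
rewrite addr_eq0 => /eqP e12.
(* Multiplying the three orthogonality relations makes a positive square equal to minus a square. *)
have : (p1 * p2 * p3) ^+ 2 = - (q1 * q2 * q3) ^+ 2.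
  transitivity ((p1 * p2) * (p2 * p3) * (p3 * p1)); first by ring.
  by rewrite e12 e23 e31; ring.
have : (p1 * p2 * p3) ^+ 2 > 0 by rewrite exprn_even_gt0 //= !mulf_neq0.
by have := sqr_ge0 (q1 * q2 * q3); lra.
Qed.

Lemma q_mx_gt3 : (2 < #|S|)%N -> (1 < #|pendant u v S|)%N -> (3 < q_mx M)%N.
Proof.
move=> /card_gt2P[a1 [a2 [a3 [[a1S a2S a3S] [a12 a23 a31]]]]].
move=> /card_gt1P[b1 [b2 [b1P b2P b12]]].
rewrite ltnNge; apply/negP => /cubic_entry[s [t [r H]]].
pose D i := M i i; pose p i := M i u; pose q i := M i v.
pose al := M u u; pose be := M v v; pose ga := M u v; pose N := M * M.
have Nsym i j : N i j = N j i.
  by rewrite !mxE; apply: eq_bigr => k _; rewrite mulrC !(Msym _ k) (Msym k).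
have ga0 : ga != 0 by exact: entry_v.
have p0 i : i \in S -> p i != 0 by exact: entry_u.
have q0 i : i != v -> q i != 0 by exact: entry_v.
have NP i j : i \in pendant u v S -> N i j = D i * M i j + q i * M v j.
  exact: row_mulmx_pendant.
have NS i j : i \in S -> N i j = D i * M i j + p i * M u j + q i * M v j.
  by case/SnB => iu iv; exact: row_mulmx.
have N3P i j : i \in pendant u v S -> (M * N) i j = D i * N i j + q i * N v j.
  exact: row_mulmx_pendant.
have N3S i j : i \in S ->
    (M * N) i j = D i * N i j + p i * N u j + q i * N v j.
  by case/SnB => iu iv; exact: row_mulmx.
have NvP b : b \in pendant u v S -> N v b = (D b + be) * q b.
  by move=> bP; rewrite Nsym NP // -/be -/(q b); ring.
have NvS a : a \in S -> N v a = (D a + be) * q a + ga * p a.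
  by move=> aS; rewrite Nsym NS // -/be -/(q a) -/(p a) -/ga; ring.
have NuS a : a \in S -> N u a = (D a + al) * p a + ga * q a.
  move=> aS; rewrite Nsym NS // -/(q a) -/(p a) -/al (Msym v u) -/ga; ring.
(* From here to [eqSS], the cubic is read at non-adjacent pairs outside [u] and [v], and the nonzero
   border entries are cancelled. *)
have eqPP b b' : b \in pendant u v S -> b' \in pendant u v S -> b != b' ->
    D b + D b' + be + s = 0.
  move=> bP b'P bb'; have [bu bv _] := PnB bP; have [b'u b'v _] := PnB b'P.
  have Mbb' : M b b' = 0 by apply: entry_eq0; rewrite ?(negbTE b'u).
  have := H b b'; rewrite N3P // NvP // NP // Mbb' (Msym v) -/(q b').
  rewrite (negbTE bb') mulr0n => E.
  apply: (mulfI (q0 b bv)); apply: (mulfI (q0 b' b'v)).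
  by rewrite !mulr0 -E; ring.
have eqPS b a : b \in pendant u v S -> a \in S ->
    (D b + D a + be + s) * q a + ga * p a = 0.
  move=> bP aS; have [bu bv bS] := PnB bP; have [au av] := SnB aS.
  have ba : b != a by apply: contraNneq bS => ->.
  have Mba : M b a = 0 by apply: entry_eq0; rewrite ?(negbTE au).
  have := H b a; rewrite N3P // NvS // NP // Mba (Msym v) -/(q a).
  rewrite (negbTE ba) mulr0n => E.
  by apply: (mulfI (q0 b bv)); rewrite mulr0 -E; ring.
have [b1u b1v _] := PnB b1P; have [b2u b2v _] := PnB b2P.
pose de := D b1.
(* Compare [eqPS] for [b1] and [b2] against the same vertex of [S]. *)
have Db2 : D b2 = de.
  have [_ a1v] := SnB a1S.
  apply/(mulIf (q0 a1 a1v))/eqP; rewrite -subr_eq0 -mulrBl; apply/eqP.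
  by rewrite -[RHS](subrr 0) -{1}(eqPS b2 a1 b2P a1S) -(eqPS b1 a1 b1P a1S) /de; ring.
have sE : s = - (be + 2 * de).
  by have := eqPP b1 b2 b1P b2P b12; rewrite Db2 -/de; lra.
pose rho i := p i / q i.
have pE a : a \in S -> p a = rho a * q a.
  by move=> /SnB[_ av]; rewrite /rho divfK ?q0.
have DS a : a \in S -> D a = de - ga * rho a.
  move=> aS; have [_ av] := SnB aS; have := eqPS b1 a b1P aS.
  rewrite -/de sE pE // => E; apply: (mulIf (q0 a av)); apply/eqP.
  by rewrite -subr_eq0 -E; apply/eqP; ring.
have rho0 a : a \in S -> rho a != 0.
  by move=> aS; have [_ av] := SnB aS; rewrite mulf_neq0 ?invr_eq0 ?p0 ?q0.
have eqSS a a' : a \in S -> a' \in S -> a != a' ->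
    ga * (rho a + rho a') = al - be.
  move=> aS a'S aa'; have [au av] := SnB aS; have [a'u a'v] := SnB a'S.
  have Maa' : M a a' = 0 by apply: entry_eq0; rewrite ?(negbTE a'u).
  have := H a a'; rewrite N3S // NvS // NuS // NS // Maa' !(Msym _ a') -/(q a').
  rewrite -/(p a') (negbTE aa') mulr0n !pE // !DS // sE => E.
  apply: (mulfI (q0 a av)); apply: (mulfI (q0 a' a'v)).
  apply: (mulfI (rho0 a aS)); apply: (mulfI (rho0 a' a'S)).
  by apply/eqP; rewrite -subr_eq0 -oppr_eq0 -E; apply/eqP; ring.
pose rh := rho a1.
(* By [eqSS] the sum of two ratios is the same for every pair; the third vertex of [S] then forces
   all ratios to be equal. *)
have rhoS a : a \in S -> rho a = rh.
  have rho_eq x y z : x \in S -> y \in S -> z \in S -> x != z -> y != z ->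
      rho x = rho y.
    move=> xS yS zS xz yz; apply: (mulfI ga0); apply: (addIr (ga * rho z)).
    by rewrite -!mulrDr !eqSS.
  move=> aS; have [->//|aa1] := eqVneq a a1; rewrite /rh.
  have [aa2|aa2] := eqVneq a a2; last by apply: (rho_eq a a1 a2).
  by apply: (rho_eq a a1 a3); rewrite // ?aa2 // eq_sym.
have rh0 : rh != 0 by exact: rho0.
have alE : al = be + 2 * ga * rh.
  by have := eqSS a1 a2 a1S a2S a12; rewrite (rhoS a2) // -/rh; lra.
pose d := de - ga * rh.
have Dd a : a \in S -> D a = d by move=> aS; rewrite DS // rhoS.
pose V := N v v.
(* In the diagonal entries at [b1] and [a1], the terms containing squares of border entries cancel
   by the relations for [s] and [al]. *)
have root_de : de ^+ 3 + s * de ^+ 2 + t * de + r = 0.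
  have := H b1 b1; rewrite N3P // NvP // NP // (Msym v) -/(q b1) -/(D b1) -/de.
  by rewrite eqxx mulr1 sE => <-; ring.
have [a1u a1v] := SnB a1S.
have root_d : d ^+ 3 + s * d ^+ 2 + t * d + r = 0.
  have := H a1 a1; rewrite N3S // NvS // NuS // NS // !(Msym _ a1) -/(q a1).
  rewrite -/(p a1) -/(D a1) eqxx mulr1 sE Dd // pE // -/rh alE => <-.
  by rewrite /d; ring.
have eqv : de ^+ 2 + de * be + V + s * (de + be) + t = 0.
  have := H b1 v; rewrite N3P // -/V NP // -/(q b1) -/be (negbTE b1v) -/de.
  by rewrite mulr0n => E; apply: (mulfI (q0 b1 b1v)); rewrite mulr0 -E; ring.
(* The difference of the two root equations, divided by [d - de]. *)
have eqd : d ^+ 2 + d * de + de ^+ 2 + s * (d + de) + t = 0.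
  have dde : d - de != 0 by rewrite /d addrC addKr oppr_eq0 mulf_neq0.
  by apply: (mulfI dde); rewrite mulr0 -[RHS](subrr 0) -{1}root_d -root_de;
    ring.
pose C := \sum_(i in S) q i ^+ 2.
have C0 : 0 <= C by apply: sumr_ge0 => i _; exact: sqr_ge0.
have NuvE : N u v = rh * C + ga * (al + be).
  rewrite mxE (sum_two_dominating _ Guv) -/al -/be -/ga [X in _ + X]big1.
    rewrite addr0 (eq_bigr (fun i => rh * q i ^+ 2)) -?mulr_sumr -/C;
      first by ring.
    by move=> i iS; rewrite (Msym u) -/(p i) -/(q i) pE // rhoS //; ring.
  move=> i /PnB[iu iv iS]; rewrite (Msym u) (_ : M i u = 0) ?mul0r //.
  by apply: entry_eq0; rewrite ?eqxx.
(* [V] is the squared norm of row [v], which has the nonzero entry [ga] besides [be]. *)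
have V_gt : 0 < V - be ^+ 2.
  have -> : V - be ^+ 2 = ga ^+ 2 + C + \sum_(i in pendant u v S) q i ^+ 2.
    rewrite /V mxE (sum_two_dominating _ Guv) -/be -/ga (Msym v u) -/ga.
    rewrite (eq_bigr (fun i => q i ^+ 2)); last by move=> i _; rewrite (Msym v).
    rewrite -/C [X in _ + X - _](eq_bigr (fun i => q i ^+ 2)); first by ring.
    by move=> i _; rewrite (Msym v).
  rewrite -addrA ltr_wpDr ?exprn_even_gt0 // addr_ge0 // sumr_ge0 // => i _.
  exact: sqr_ge0.
(* The entry at [a1] and [v], divided by [q a1], minus [eqv]. *)
have eqSv : (d - de) * (al - de) = rh ^+ 2 * C.
  have := H a1 v; rewrite N3S // -/V NuvE.
  have -> : N a1 v = (d + be) * q a1 + ga * p a1 by rewrite Nsym NvS // Dd.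
  rewrite -/(q a1) (negbTE a1v) mulr0n pE // Dd // -/rh => E.
  apply: (mulfI (q0 a1 a1v)); have := congr1 ( *%R (q a1)) eqv.
  by move: E; rewrite sE /d mulr0; lra.
have eqV : V - be ^+ 2 = (d - de) ^+ 2 - (d - de) * (be - de).
  by move: eqd eqv; rewrite sE; lra.
(* By [eqSv], [(d - de) * (be - de)] is at least [2 * (d - de) ^+ 2]; by [V_gt] and [eqV] it is less
   than [(d - de) ^+ 2]. *)
have := mulr_ge0 (sqr_ge0 rh) C0; rewrite -eqSv.
have -> : al = be + 2 * (de - d) by rewrite alE /d; ring.
by have := sqr_ge0 (d - de); move: V_gt; rewrite eqV; lra.
Qed.
End LowerBounds.

(** * Upper bounds from explicit bordered matrices *)

(** The tests for [v] precede those for [u], so the entry joining [u] and [v] is [Q u]. *)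
Definition bordered (R : realType) (n : nat) (D P Q : 'I_n -> R) (u v : 'I_n) :
    'M[R]_n :=
  \matrix_(i, j)
    if i == j then D i else if j == v then Q i else if i == v then Q j
    else if j == u then P i else if i == u then P j else 0.

(** Only the values on [S] may vary: the case of two twins gives them different diagonal entries. *)
Definition piecewise (R : Type) (n : nat) (u v : 'I_n) (S : {set 'I_n})
    (a : 'I_n -> R) (b c d : R) (i : 'I_n) : R :=
  if i \in S then a i else if i == u then b else if i == v then c else d.

Section UpperBounds.
Context (R : realType) (n : nat) (G : sgraph n) (u v : 'I_n).
Context (S : {set 'I_n}) (Guv : two_dominating G u v S).

Let uv : u != v. Proof. by case: Guv. Qed.
Let uS : u \in S = false. Proof. by case: Guv => _ /negbTE. Qed.
Let vS : v \in S = false. Proof. by case: Guv => _ _ /negbTE. Qed.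
Let SnB x : x \in S -> x != u /\ x != v.
Proof. by move=> xS; split; apply: contraTneq xS => ->; rewrite ?uS ?vS. Qed.
Let PnB x : x \in pendant u v S -> [/\ x != u, x != v & x \notin S].
Proof. by rewrite !inE !negb_or => /and3P. Qed.

Lemma bordered_in_S (D P Q : 'I_n -> R) :
  (forall i, (P i != 0) = (i \in S)) -> (forall i, i != v -> Q i != 0) ->
  in_S G (bordered D P Q u v).
Proof.
move=> P0 Q0; split; first apply/matrixP => i j; last move=> i j ij.
  rewrite !mxE eq_sym; have [->//|ij] := eqVneq i j.
  have [jv|jv] := eqVneq j v; have [iv|iv] := eqVneq i v => //.
    by rewrite jv iv eqxx in ij.
  have [ju|ju] := eqVneq j u; have [iu|iu] := eqVneq i u => //.
  by rewrite ju iu eqxx in ij.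
case: Guv => _ _ _ -> //; rewrite mxE (negbTE ij).
have [jv|jv] := eqVneq j v; first by rewrite orbT Q0 // -jv.
have [iv|iv] := eqVneq i v; first by rewrite Q0.
have [ju|ju] := eqVneq j u; have [iu|iu] := eqVneq i u; rewrite /= ?P0 ?orbF //.
  by rewrite ju iu eqxx in ij.
by rewrite eqxx.
Qed.

(** The eigenvector equations replace the characteristic polynomial: it suffices that they have only
    the zero solution for every [l] outside [rs]. *)
Lemma bordered_q_le (D P Q : 'I_n -> R) (rs : seq R) :
  (forall l (x : 'I_n -> R), l \notin rs ->
     (forall i, i \in S -> D i * x i + P i * x u + Q i * x v = l * x i) ->
     (forall i, i \in pendant u v S -> D i * x i + Q i * x v = l * x i) ->
     \sum_(i in S) P i * x i + D u * x u + Q u * x v = l * x u ->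
     \sum_(i in S) Q i * x i + \sum_(i in pendant u v S) Q i * x i +
       Q u * x u + D v * x v = l * x v ->
     forall i, x i = 0) ->
  (forall i, (P i != 0) = (i \in S)) ->
  (q_mx (bordered D P Q u v) <= size rs)%N.
Proof.
move=> Hrs P0; apply: q_mx_le => l /eigenvalueP[x xA x0].
apply: contraNT x0 => lrs; apply/eqP/rowP => i; rewrite mxE.
pose f j := x 0 j; rewrite -/(f i).
have Pout j : j \notin S -> P j = 0 by rewrite -P0 negbK => /eqP.
(* Eigenvectors are rows here, so the equations come from columns; symmetry of the matrix gives them
   the form of row equations. *)
have E j : f u * bordered D P Q u v u j + f v * bordered D P Q u v v j +
    \sum_(k in S) f k * bordered D P Q u v k j +
    \sum_(k in pendant u v S) f k * bordered D P Q u v k j = l * f j.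
  by rewrite -(sum_two_dominating _ Guv); move/rowP: xA => /(_ j); rewrite !mxE.
have vu : v == u = false by rewrite eq_sym (negbTE uv).
have off j k : j != u -> j != v -> k != u -> k != v ->
    f k * bordered D P Q u v k j = if k == j then D j * f j else 0.
  move=> /negbTE ju /negbTE jv /negbTE ku /negbTE kv.
  by rewrite mxE ju jv ku kv; case: eqP => [->|_]; rewrite ?mulr0 // mulrC.
have sumS j (A : {set 'I_n}) : j != u -> j != v ->
    (forall k, k \in A -> k != u /\ k != v) ->
    \sum_(k in A) f k * bordered D P Q u v k j = if j \in A then D j * f j else 0.
  move=> ju jv An; have [jA|jA] := boolP (j \in A).
    rewrite (bigD1 j) //= off // eqxx big1 ?addr0 // => k /andP[kA kj].
    by have [ku kv] := An k kA; rewrite off // (negbTE kj).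
  rewrite big1 // => k kA; have [ku kv] := An k kA.
  by rewrite off //; case: eqP kA jA => // -> ->.
have PnB' k : k \in pendant u v S -> k != u /\ k != v by case/PnB.
apply: (Hrs l f lrs).
- move=> j jS; have [ju jv] := SnB jS; have jP : j \in pendant u v S = false.
    by rewrite !inE jS !orbT.
  have := E j; rewrite !sumS // jS jP !mxE [u == j]eq_sym [v == j]eq_sym.
  by rewrite !eqxx (negbTE ju) (negbTE jv) (negbTE uv) => <-; ring.
- move=> j jP; have [ju jv jS] := PnB jP.
  have := E j; rewrite !sumS // (negbTE jS) jP !mxE [u == j]eq_sym [v == j]eq_sym.
  by rewrite !eqxx (negbTE ju) (negbTE jv) (negbTE uv) Pout // => <-; ring.
- have := E u; rewrite !mxE !eqxx (negbTE uv) vu => <-.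
  rewrite [X in _ = _ + X]big1; last first.
    move=> k /PnB[ku kv kS].
    by rewrite mxE (negbTE ku) (negbTE kv) (negbTE uv) eqxx Pout ?mulr0.
  rewrite [in RHS](eq_bigr (fun k => P k * f k)); first by ring.
  move=> k /SnB[ku kv].
  by rewrite mxE (negbTE ku) (negbTE kv) (negbTE uv) eqxx mulrC.
- have := E v; rewrite !mxE !eqxx (negbTE uv) => <-.
  have QE k : k != v -> f k * bordered D P Q u v k v = Q k * f k.
    by move=> /negbTE kv; rewrite mxE kv eqxx mulrC.
  rewrite [X in _ = _ + X + _](eq_bigr (fun k => Q k * f k)); last first.
    by move=> k /SnB[_ kv]; exact: QE.
  rewrite [X in _ = _ + _ + X](eq_bigr (fun k => Q k * f k)); last first.
    by move=> k /PnB[_ kv _]; exact: QE.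
  by ring.
Qed.

Local Notation pw := (piecewise u v S).

Let pwS (a : 'I_n -> R) b c d i : i \in S -> pw a b c d i = a i.
Proof. by rewrite /piecewise => ->. Qed.
Let pwu (a : 'I_n -> R) b c d : pw a b c d u = b.
Proof. by rewrite /piecewise uS eqxx. Qed.
Let pwv (a : 'I_n -> R) b c d : pw a b c d v = c.
Proof. by rewrite /piecewise vS eq_sym (negbTE uv) eqxx. Qed.
Let pwP (a : 'I_n -> R) b c d i : i \in pendant u v S -> pw a b c d i = d.
Proof. by move=> /PnB[/negbTE iu /negbTE iv /negbTE iS];
  rewrite /piecewise iS iu iv. Qed.

Let sum_pwS (a : 'I_n -> R) b c d (x : 'I_n -> R) :
  \sum_(i in S) pw a b c d i * x i = \sum_(i in S) a i * x i.
Proof. by apply: eq_bigr => i /pwS ->. Qed.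
Let sum_pwP (a : 'I_n -> R) b c d (x : 'I_n -> R) :
  \sum_(i in pendant u v S) pw a b c d i * x i =
  d * \sum_(i in pendant u v S) x i.
Proof. by rewrite mulr_sumr; apply: eq_bigr => i /pwP ->. Qed.

(** Once [x u] and [x v] vanish, the other equations are diagonal, and only an [l] equal to a
    diagonal entry needs a separate argument. *)
Let vanish (a : 'I_n -> R) b c d (p : 'I_n -> R) (q : 'I_n -> R) b' c' d'
    (x : 'I_n -> R) (l : R) :
  (forall i, i \in S ->
    pw a b c d i * x i + p i * x u + pw q b' c' d' i * x v = l * x i) ->
  (forall i, i \in pendant u v S ->
    pw a b c d i * x i + pw q b' c' d' i * x v = l * x i) ->
  x u = 0 -> x v = 0 ->
  (forall i, i \in S -> l = a i -> x i = 0) ->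
  (forall i, i \in pendant u v S -> l = d -> x i = 0) ->
  forall i, x i = 0.
Proof.
move=> hS hP xu xv hSl hPl i.
have [->//|iu] := eqVneq i u; have [->//|iv] := eqVneq i v.
have [iS|iS] := boolP (i \in S).
  have := hS i iS; rewrite xu xv !mulr0 !addr0 pwS // => /eqP.
  rewrite -subr_eq0 -mulrBl mulf_eq0 subr_eq0 => /orP[/eqP h|/eqP //].
  exact: hSl.
have iP : i \in pendant u v S by rewrite !inE !negb_or iu iv.
have := hP i iP; rewrite xv mulr0 addr0 pwP // => /eqP.
rewrite -subr_eq0 -mulrBl mulf_eq0 subr_eq0 => /orP[/eqP h|/eqP //].
exact: hPl.
Qed.

Local Notation k1 := (#|S|%:R : R).
Local Notation k2 := (#|pendant u v S|%:R : R).

(** Summing the equations of twins yields an equation of the quotient. *)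
Let sum_S (x : 'I_n -> R) (l c e : R) :
  (forall i, i \in S -> (l - c) * x i = e) ->
  (l - c) * \sum_(i in S) x i = k1 * e.
Proof.
by move=> h; rewrite mulr_sumr (eq_bigr _ h) sumr_const mulr_natl.
Qed.
Let sum_P (x : 'I_n -> R) (l c e : R) :
  (forall i, i \in pendant u v S -> (l - c) * x i = e) ->
  (l - c) * \sum_(i in pendant u v S) x i = k2 * e.
Proof.
by move=> h; rewrite mulr_sumr (eq_bigr _ h) sumr_const mulr_natl.
Qed.

Let ind_S (c : R) : c != 0 -> forall i, ((if i \in S then c else 0) != 0) = (i \in S).
Proof. by move=> c0 i; case: ifP => _ //; rewrite eqxx. Qed.

(* The quotient of order 4 has rank 2, and its entries make its nonzero
   eigenvalues [1 + k1], the diagonal entry of the pendant vertices, and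
   [(1 + k1) * (1 + k2) + k1]; the twins in [S] add the eigenvalue 1. *)
Lemma small_q (rs : seq R) : (0 < #|S|)%N ->
  0 \in rs -> (1 + k1) * (1 + k2) + k1 \in rs ->
  (#|S| == 1%N) || (1 \in rs) -> (#|pendant u v S| == 0%N) || (1 + k1 \in rs) ->
  exists2 A : 'M[R]_n, in_S G A & (q_mx A <= size rs)%N.
Proof.
move=> S0 rs0 rsy rs1 rsd; have k1_gt0 : 0 < k1 by rewrite ltr0n.
pose de := 1 + k1; have de0 : de != 0 by rewrite /de; lra.
(* Row [u] is the sum of the rows of [S], and row [v] adds the pendant rows to it. For [l != 0] this
   gives [x u] as the sum of [x] over [S], and [x v] as that sum plus the sum over the pendant
   vertices. *)
exists (bordered (pw (fun=> 1) k1 (k1 + k2 * de) de)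
  (fun i => if i \in S then 1 else 0) (pw (fun=> 1) k1 0 de) u v).
  apply: bordered_in_S => [|i iv]; first by apply: ind_S; exact: oner_neq0.
  rewrite /piecewise (negbTE iv); case: ifP => _; first exact: oner_neq0.
  by case: ifP => _ //; rewrite gt_eqF.
apply: bordered_q_le; last by apply: ind_S; exact: oner_neq0.
move=> l x lrs hS hP; rewrite !sum_pwS sum_pwP !pwu !pwv.
rewrite (eq_bigr x); last by move=> i ->; rewrite mul1r.
rewrite [X in _ -> X + _ + _ + _ = _ -> _](eq_bigr x); last by move=> i _;
  rewrite mul1r.
have l_neq a : a \in rs -> l != a by move=> ars; apply: contraNneq lrs => ->.
have l0 := l_neq _ rs0; have ly := l_neq _ rsy.
set sg := \sum_(i in S) x i; set ta := \sum_(i in pendant u v S) x i.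
set U := x u; set V := x v => hu hv.
have hS' i : i \in S -> (l - 1) * x i = U + V.
  by move=> iS; have := hS i iS; rewrite iS !pwS // -/U -/V; lra.
have esg : (l - 1) * sg = k1 * (U + V) by exact: sum_S.
have eta : (l - de) * ta = k2 * (de * V).
  by apply: sum_P => i iP; have := hP i iP; rewrite !pwP // -/V; lra.
have sgU : sg = U by apply: (mulfI l0); rewrite -hu; lra.
have eU : k1 * V = (l - de) * U by move: hu; rewrite sgU /de; lra.
have eV : k2 * (de * V) = (l - de) * (V - U).
  apply: (mulfI l0); have := congr1 ( *%R (l - de)) hu;
    have := congr1 ( *%R (l - de)) hv.
  have := congr1 ( *%R de) eta; lra.
have V0 : V = 0.
  have : (l - ((1 + k1) * (1 + k2) + k1)) * V = 0 by move: eU eV; rewrite /de;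
    lra.
  by move=> /eqP; rewrite mulf_eq0 subr_eq0 (negbTE ly) => /eqP.
have U0 : U = 0.
  case/orP: rsd => [P0|/l_neq ld].
    move: hv; rewrite /ta big_pred0; last by move=> i;
      rewrite (cards0_eq (eqP P0)) inE.
    rewrite (eqP P0) V0 mulr0n => hv; apply: (mulfI l0); move: hu hv;
      rewrite V0; lra.
  by move: eU; rewrite V0 mulr0 => /esym/eqP;
    rewrite mulf_eq0 subr_eq0 (negbTE ld) => /eqP.
apply: (vanish hS hP) => //.
(* If 1 is not listed then [S] is a single vertex, whose coordinate is [sg = U = 0]. *)
- move=> i iS l1; have /cards1P[a Sa] : #|S| == 1%N by case/orP: rs1 => // /l_neq; rewrite l1 eqxx.
  by move: sgU iS; rewrite /sg Sa big_set1 U0 inE => <- /eqP ->.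
- move=> i iP ld; case/orP: rsd => [P0|/l_neq]; last by rewrite ld eqxx.
  by rewrite (cards0_eq (eqP P0)) inE in iP.
Qed.

(* Here the quotient of order 4 has rank 2 and its nonzero eigenvalues are 3, the
   diagonal entry of the twins in [S], and [6 * k1 + 5]. *)
Lemma q_le3_one_pendant : (0 < #|S|)%N -> #|pendant u v S| = 1%N ->
  exists2 A : 'M[R]_n, in_S G A & (q_mx A <= 3)%N.
Proof.
move=> S0 /eqP/cards1P[b Pb]; have k1_gt0 : 0 < k1 by rewrite ltr0n.
(* Row [u] is the sum of the rows of [S], and row [v] is row [u] plus twice the pendant row; hence
   [UE]. *)
exists (bordered (pw (fun=> 3) (3 * k1) (3 * k1 + 4) 1)
  (fun i => if i \in S then 3 else 0) (pw (fun=> 3) (3 * k1) 0 2) u v).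
  apply: bordered_in_S => [|i iv]; first by apply: ind_S; rewrite pnatr_eq0.
  rewrite /piecewise (negbTE iv); case: ifP => _; first by rewrite pnatr_eq0.
  by case: ifP => _; apply: lt0r_neq0; lra.
apply: (bordered_q_le (rs := [:: 0; 3; 6 * k1 + 5])); last first.
  by apply: ind_S; rewrite pnatr_eq0.
move=> l x; rewrite !inE !negb_or => /and3P[l0 l3 ly] hS hP.
rewrite !sum_pwS sum_pwP !pwu !pwv Pb big_set1.
rewrite (eq_bigr (fun i => 3 * x i)); last by move=> i ->.
rewrite -mulr_sumr; set sg := \sum_(i in S) x i.
have := hP b; rewrite Pb set11 !pwP ?Pb ?set11 // => /(_ isT).
set B := x b; set U := x u; set V := x v => hb hu hv.
have esg : (l - 3) * sg = k1 * (3 * (U + V)).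
  by apply: sum_S => i iS; have := hS i iS; rewrite iS !pwS // -/U -/V; lra.
have UE : U = V - 2 * B by apply: (mulfI l0); move: hb hu hv; lra.
have eU : 3 * k1 * (U + V) = (l - 3) * U.
  by apply: (mulfI l0); have := congr1 ( *%R (l - 3)) hu; move: esg; lra.
have B0 : B = 0.
  apply/eqP; have : (l - 3) * ((l - (6 * k1 + 5)) * B) = 0.
    have VE : V = (l - 1) * B / 2 by move: hb; lra.
    by move: eU; rewrite UE VE; lra.
  by move=> /eqP; rewrite !mulf_eq0 !subr_eq0 (negbTE l3) (negbTE ly).
have V0 : V = 0 by move: hb; rewrite B0; lra.
have U0 : U = 0 by rewrite UE B0 V0; lra.
apply: (vanish hS hP U0 V0) => [i _ l3'|i]; first by rewrite l3' eqxx in l3.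
by rewrite Pb inE => /eqP ->.
Qed.

(* The quotient of order 5 is annihilated by
   ['X * ('X ^ 2 - 5 * k2 * 'X - 9 * (1 + k2))]. *)
Lemma q_le3_two_twins : #|S| = 2%N -> (0 < #|pendant u v S|)%N ->
  exists2 A : 'M[R]_n, in_S G A & (q_mx A <= 3)%N.
Proof.
move=> /eqP/cards2P[a1 [a2 [a12 Sa]]] P0; have k2_gt0 : 0 < k2 by rewrite ltr0n.
(* The entries solve [DS] and [eqSS] of the cubic lower bound with [de = 0], [ga = 1] and ratios [1]
   and [- (1 + k2)]; with only two twins these ratios may differ. *)
pose D i : R := if i == a1 then -1 else 1 + k2.
pose p i : R := if i \in S then if i == a1 then 2 else - (2 * (1 + k2)) else 0.
have p_supp i : (p i != 0) = (i \in S).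
  rewrite /p; case: ifP => _; rewrite ?eqxx //.
  by case: ifP => _; rewrite ?oppr_eq0; apply: lt0r_neq0; lra.
exists (bordered (pw D (4 * k2) (5 * k2) 0) p (pw (fun=> 2) 1 0 3) u v).
  apply: bordered_in_S => // i iv.
  rewrite /piecewise (negbTE iv); case: ifP => _; first by rewrite pnatr_eq0.
  by case: ifP => _; apply: lt0r_neq0; lra.
(* The square root of the discriminant of the quadratic factor. *)
pose dl := Num.sqrt (25 * k2 ^+ 2 + 36 * (1 + k2)).
have dl2 : dl ^+ 2 = 25 * k2 ^+ 2 + 36 * (1 + k2).
  by rewrite sqr_sqrtr //; have := sqr_ge0 k2; lra.
apply: (bordered_q_le (rs := [:: 0; (5 * k2 + dl) / 2; (5 * k2 - dl) / 2]))
  => // l x; rewrite !inE !negb_or => /and3P[l0 l1 l2] hS hP.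
have W0 : l ^+ 2 - 5 * k2 * l - 9 * (1 + k2) != 0.
  have -> : l ^+ 2 - 5 * k2 * l - 9 * (1 + k2) =
      (l - (5 * k2 + dl) / 2) * (l - (5 * k2 - dl) / 2) by lra.
  by rewrite mulf_neq0 ?subr_eq0.
have sumSE (f : 'I_n -> R) : \sum_(i in S) f i = f a1 + f a2.
  by rewrite Sa big_setU1 ?inE //= big_set1.
rewrite !sum_pwS sum_pwP !pwu !pwv !sumSE.
have a1S : a1 \in S by rewrite Sa !inE eqxx.
have a2S : a2 \in S by rewrite Sa !inE eqxx orbT.
have := hS a1 a1S; have := hS a2 a2S.
rewrite /p a1S a2S !pwS // /D eqxx [a2 == a1]eq_sym (negbTE a12).
set U := x u; set V := x v; set x1 := x a1; set x2 := x a2.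
set ta := \sum_(i in _) x i => h2 h1 hu hv.
have eta : (l - 0) * ta = k2 * (3 * V).
  by apply: sum_P => i iP; have := hP i iP; rewrite !pwP // -/V; lra.
have V0 : V = 0.
  apply: (mulfI W0); rewrite mulr0.
  have := congr1 ( *%R l) hv; move: h1 h2 hu eta; lra.
have ta0 : ta = 0 by apply: (mulfI l0); move: eta; rewrite V0; lra.
have UE : U = - (2 * (x1 + x2)) by move: hv; rewrite V0 ta0; lra.
rewrite V0 UE in h1 h2.
have x20 : x2 = 0.
  apply: (mulfI W0); rewrite mulr0; have := congr1 ( *%R (1 + k2)) h1.
  by have := congr1 ( *%R (l + 5)) h2; lra.
have x10 : x1 = 0.
  have k2_neq0 : 1 + k2 != 0 by apply: lt0r_neq0; lra.
  by apply: (mulfI k2_neq0); move: h2; rewrite x20; lra.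
apply: (vanish hS hP) => //.
- by rewrite -/U UE x10 x20; lra.
- by move=> i; rewrite Sa !inE => /orP[] /eqP ->.
- by move=> i _ l0'; rewrite l0' eqxx in l0.
Qed.
End UpperBounds.

(** * The minimum and the case distinction *)

Lemma q_graph_eq (R : realType) (n k : nat) (G : sgraph n) :
  (forall A : 'M[R]_n, in_S G A -> (k <= q_mx A)%N) ->
  (exists2 A : 'M[R]_n, in_S G A & (q_mx A <= k)%N) ->
  q_graph R G = k.
Proof.
move=> k_le [A AG qA]; rewrite /q_graph; case: ex_minnP => m.
move=> /asboolP[B BG <-] m_min; apply/eqP; rewrite eqn_leq k_le // andbT.
by apply: leq_trans qA; apply: m_min; apply/asboolP; exists A.
Qed.

Local Close Scope ring_scope.

Theorem theorem6p5 (R : realType) (n k1 k2 : nat) (G : sgraph n)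
    (n_ge5 : (5 <= n)%N) (k1_ge1 : (1 <= k1)%N) (k2_ge0 : (0 <= k2)%N)
    (G_thr : is_threshold G
       (nseq k1 false ++ [:: true] ++ nseq k2 false ++ [:: true])) :
  q_graph R G =
    if (k1 \in [:: 1; 2]%N) || (k2 \in [:: 0; 1]%N) then 3%N else 4%N.
Proof.
have [u [v [S [Guv cS cP nE]]]] := threshold_two_dominating G_thr.
case: n => [|n] in G n_ge5 G_thr u v S Guv cS cP nE *; first by [].
have S_gt0 : (0 < #|S|)%N by rewrite cS.
pose y : R := ((1 + #|S|%:R) * (1 + #|pendant u v S|%:R) + #|S|%:R)%R.
rewrite !inE; case: ifPn => k12; apply: q_graph_eq.
- move=> A AG; have [k20|k2_gt0] := posnP k2.
    (* With [k2 = 0], the order being at least 5 gives [k1 >= 3]. *)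
    by apply: (q_mx_gt2_twins Guv AG); rewrite cS; lia.
  by apply: (q_mx_gt2_pendant Guv AG) => //; rewrite cP.
(* The four values of the general construction drop to three: 1 is omitted for [k1 = 1], and
   [1 + k1] for [k2 = 0]. *)
- have [k1_1|k1_1] := eqVneq k1 1%N.
    apply: (small_q Guv (rs := [:: 0; y; 1 + #|S|%:R]%R)) => //;
      by rewrite ?inE ?eqxx ?orbT // cS k1_1.
  have [k2_0|k2_0] := eqVneq k2 0%N.
    apply: (small_q Guv (rs := [:: 0; y; 1]%R)) => //;
      by rewrite ?inE ?eqxx ?orbT // cP k2_0.
  have [k2_1|k2_1] := eqVneq k2 1%N.
    by apply: (q_le3_one_pendant R Guv) => //; rewrite cP.
  have k1_2 : k1 = 2%N by lia.
  apply: (q_le3_two_twins R Guv); first by rewrite cS.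
  by rewrite cP lt0n.
- by move=> A AG; apply: (q_mx_gt3 Guv AG); rewrite ?cS ?cP; lia.
- apply: (small_q Guv (rs := [:: 0; y; 1; 1 + #|S|%:R]%R)) => //;
    by rewrite ?inE ?eqxx ?orbT.
Qed.
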